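(* Let $\perp$ be an invariant ternary relation on small subsets of $\mathbb M$ satisfying symmetry, full existence, stationarity over models, and the following weak transitivity over models: for all small models $M$ and all small tuples $a,b,d$, $$a\perp_{Md} b \ \text{ and }\ a\perp^{h}_M d\ \text{ and }\ b\perp^{u}_M d\ \Longrightarrow\ a\perp_M b .$$ Then $T$ is NSOP$_4$.
   Context: Setting. $T$ is a complete first-order theory with only infinite models in an at most countable language $L$. $\mathbb M$ is a monster model of $T$: for a fixed big enough cardinal $\bar\kappa$ (e.g. strongly inaccessible), $\mathbb M$ is $\bar\kappa^+$-universal, $\bar\kappa$-saturated and strongly $\bar\kappa$-homogeneous. ''Small'' means of cardinality $<\bar\kappa$; all sets $A,B,C,\dots$ and (possibly infinite) tuples $a,b,c,\dots$ of $\mathbb M$ are small, and a small model is a small elementary substructure of $\mathbb M$. Juxtaposition denotes union; a tuple used in place of a set stands for the set of its coordinates. $a\equiv_C b$ means $\mathrm{tp}(a/C)=\mathrm{tp}(b/C)$ (equivalently $\sigma(a)=b$ for some $\sigma\in\mathrm{Aut}(\mathbb M/C)$); for sets, $A\equiv_C B$ means $\sigma(A)=B$ for some $\sigma\in \mathrm{Aut}(\mathbb M/C)$. A ternary relation $\perp$ is invariant if $A\perp_C B\iff \sigma(A)\perp_{\sigma(C)}\sigma(B)$ for all $\sigma\in\mathrm{Aut}(\mathbb M)$. Axioms. - Symmetry: $A\perp_C B\Rightarrow B\perp_C A$. - Full existence: for all $A,B,C$ there is $A'\equiv_C A$ with $A'\perp_C B$. - Stationarity over models: for every small model $M$, if $C_1\perp_M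 A$, $C_2\perp_M A$ and $C_1\equiv_M C_2$ then $C_1\equiv_{MA}C_2$ (for tuples: $c_1\equiv_M c_2$ implies $c_1\equiv_{MA}c_2$). Heirs and coheirs. $a\perp^{h}_C b$ means $\mathrm{tp}(a/Cb)$ is an heir of $\mathrm{tp}(a/C)$: for every $\phi(x,b')\in \mathrm{tp}(a/Cb)$, with $\phi(x,y)$ an $L(C)$-formula and $b'$ a tuple from $Cb$, there is a tuple $c$ from $C$ with $\phi(x,c)\in\mathrm{tp}(a/C)$. $a\perp^{u}_C b$ means $\mathrm{tp}(a/Cb)$ is finitely satisfiable in $C$: every formula in it is satisfied by a tuple from $C$. NSOP$_n$ ($n\ge 3$). $T$ has the $n$-strong order property if there is an indiscernible sequence $(a_i)_{i<\omega}$ (over $\emptyset$) such that, for $p(x,y)=\mathrm{tp}(a_0,a_1)$, the type $p(x_1,x_2)\cup p(x_2,x_3)\cup\dots\cup p(x_{n-1},x_n)\cup p(x_n,x_1)$ is inconsistent. $T$ is NSOP$_n$ if it does not have the $n$-strong order property. *)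

(* Defs.v *)
(* Written in MathComp, with sets and cardinals from MathComp-Analysis.

   The cardinal called kappa-bar in the text is represented by a type [kappa]
   of that cardinality. *)
From mathcomp Require Import all_boot.
From mathcomp Require Import boolp classical_sets functions cardinality.

Set Implicit Arguments.
Unset Strict Implicit.
Unset Printing Implicit Defensive.

Local Open Scope classical_set_scope.
Local Open Scope card_scope.

Record language := Language {
  fsym : Type;
  rsym : Type;
  farity : fsym -> nat;
  rarity : rsym -> nat }.

Definition countable_language (L : language) : Prop :=
  countable [set: fsym L] /\ countable [set: rsym L].

(* [term L V] and [formula L V] are the terms and formulas whose free variables
   are among the elements of [V]; a quantifier binds the variable [None] of
   [option V].  Parameters are treated as extra free variables: an L(C)-formula
   in the variables [I] is a formula over [I + C].  The connectives and the
   quantifier below are complete for classical logic. *)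
Inductive term (L : language) (V : Type) : Type :=
| Var of V
| App (f : fsym L) of ('I_(farity f) -> term L V).

Inductive formula (L : language) (V : Type) : Type :=
| Bot
| Eqt of term L V & term L V
| Rel (r : rsym L) of ('I_(rarity r) -> term L V)
| Imp of formula L V & formula L V
| All of formula L (option V).

Arguments Bot {L V}.

Definition Not (L : language) (V : Type) (phi : formula L V) : formula L V :=
  Imp phi Bot.

Fixpoint trename (L : language) (V W : Type) (h : V -> W) (t : term L V) :
    term L W :=
  match t with
  | Var x => Var L (h x)
  | App f ts => App (fun i => trename h (ts i))
  end.

Fixpoint rename (L : language) (V W : Type) (h : V -> W) (phi : formula L V) :
    formula L W :=
  match phi with
  | Bot => Bot
  | Eqt t u => Eqt (trename h t) (trename h u)
  | Rel r ts => Rel (fun i => trename h (ts i))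
  | Imp phi1 phi2 => Imp (rename h phi1) (rename h phi2)
  | All phi1 => All (rename (omap h) phi1)
  end.

Record structure (L : language) := Structure {
  carrier :> Type;
  carrier_inhabited : inhabited carrier;
  fint : forall f : fsym L, ('I_(farity f) -> carrier) -> carrier;
  rint : forall r : rsym L, ('I_(rarity r) -> carrier) -> Prop }.

Section Semantics.
Variables (L : language) (M : structure L).

Fixpoint eval (V : Type) (v : V -> M) (t : term L V) : M :=
  match t with
  | Var x => v x
  | App f ts => fint (fun i => eval v (ts i))
  end.

Fixpoint sat (V : Type) (v : V -> M) (phi : formula L V) : Prop :=
  match phi with
  | Bot => False
  | Eqt t u => eval v t = eval v u
  | Rel r ts => rint (fun i => eval v (ts i))
  | Imp phi1 phi2 => sat v phi1 -> sat v phi2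
  | All phi1 =>
      forall x : M, sat (fun z => if z is Some y then v y else x) phi1
  end.

Definition realizes (V : Type) (v : V -> M) (p : set (formula L V)) : Prop :=
  forall phi, p phi -> sat v phi.

End Semantics.

Definition sentence (L : language) : Type := formula L void.

Definition models (L : language) (T : set (sentence L)) (N : structure L) :
    Prop :=
  realizes (of_void N) T.

Definition entails (L : language) (T : set (sentence L)) (phi : sentence L) :
    Prop :=
  forall N : structure L, models T N -> sat (of_void N) phi.

Definition complete_theory (L : language) (T : set (sentence L)) : Prop :=
  (exists N : structure L, models T N) /\
  (forall phi, entails T phi \/ entails T (Not phi)).

Definition consistent (L : language) (T : set (sentence L)) (V : Type)
    (p : set (formula L V)) : Prop :=
  exists (N : structure L) (v : V -> N), models T N /\ realizes v p.

(* A map [e] defined on the subset [D] of [N] is elementary. *)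
Definition elementary_on (L : language) (N M : structure L) (D : set N)
    (e : N -> M) : Prop :=
  forall (n : nat) (phi : formula L 'I_n) (v : 'I_n -> N),
    (forall i, D (v i)) -> (sat v phi <-> sat (e \o v) phi).

Definition elementary_embedding (L : language) (N M : structure L)
    (e : N -> M) : Prop :=
  elementary_on [set: N] e.

Definition automorphism (L : language) (M : structure L) (s : M -> M) : Prop :=
  [/\ bijective s,
      (forall (f : fsym L) v, s (@fint L M f v) = fint (s \o v)) &
      (forall (r : rsym L) v, @rint L M r v <-> rint (s \o v))].

Definition fixes (X : Type) (C : set X) (s : X -> X) : Prop :=
  forall x, C x -> s x = x.

Definition card_lt (X Y : Type) (A : set X) (B : set Y) : Prop :=
  A #<= B /\ ~ (B #<= A).

Definition small (kappa X : Type) (A : set X) : Prop :=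
  card_lt A [set: kappa].

(* Tuples of elements of [X] are functions from an index type to [X]; the tuple
   is small when its index type is.  [tcat a b] is the concatenation. *)
Definition tcat (X I J : Type) (a : I -> X) (b : J -> X) : I + J -> X :=
  fun z => match z with inl i => a i | inr j => b j end.

Definition elem (X : Type) (C : set X) : C -> X := fun c => \val c.

Definition tp0 (L : language) (M : structure L) (I : Type) (a : I -> M) :
    set (formula L I) :=
  [set phi | sat a phi].

(* The type of [a] over [C]. *)
Definition tp (L : language) (M : structure L) (C : set M) (I : Type)
    (a : I -> M) : set (formula L (I + C)%type) :=
  tp0 (tcat a (@elem M C)).

Arguments tp {L M} C {I} a.

Definition saturated (kappa : Type) (L : language) (M : structure L) : Prop :=
  forall (A : set M) (n : nat) (p : set (formula L ('I_n + A)%type)),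
    small kappa A ->
    (forall q, finite_set q -> q `<=` p ->
       exists x : 'I_n -> M, realizes (tcat x (@elem M A)) q) ->
    exists x : 'I_n -> M, realizes (tcat x (@elem M A)) p.

Definition strongly_homogeneous (kappa : Type) (L : language)
    (M : structure L) : Prop :=
  forall (A : set M) (e : M -> M), small kappa A -> elementary_on A e ->
    exists2 s : M -> M, automorphism s & forall x, A x -> s x = e x.

(* Cardinality less than the successor of [kappa] is cardinality at most
   [kappa]. *)
Definition succ_universal (kappa : Type) (L : language)
    (T : set (sentence L)) (M : structure L) : Prop :=
  forall N : structure L, models T N -> [set: N] #<= [set: kappa] ->
    exists e : N -> M, elementary_embedding e.

Definition monster (kappa : Type) (L : language) (T : set (sentence L))
    (M : structure L) : Prop :=
  [/\ models T M,
      succ_universal kappa T M,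
      saturated kappa M &
      strongly_homogeneous kappa M].

Section Independence.
Variables (kappa : Type) (L : language) (M : structure L).

(* [S] is the underlying set of an elementary substructure of [M]. *)
Definition elementary_sub (S : set M) : Prop :=
  exists (N : structure L) (e : N -> M),
    elementary_embedding e /\ range e = S.

Definition small_model (S : set M) : Prop :=
  small kappa S /\ elementary_sub S.

Definition equiv_tuple (C : set M) (I : Type) (a b : I -> M) : Prop :=
  tp C a = tp C b.

Definition equiv_set (C A B : set M) : Prop :=
  exists s : M -> M, [/\ automorphism s, fixes C s & s @` A = B].

Definition heir (I J : Type) (a : I -> M) (C : set M) (b : J -> M) : Prop :=
  forall (k : nat) (phi : formula L ((I + 'I_k) + C)%type) (b' : 'I_k -> M),
    (forall j, (C `|` range b) (b' j)) ->
    sat (tcat (tcat a b') (@elem M C)) phi ->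
    exists2 c : 'I_k -> M, (forall j, C (c j)) &
      sat (tcat (tcat a c) (@elem M C)) phi.

Definition coheir (I J : Type) (a : I -> M) (C : set M) (b : J -> M) : Prop :=
  forall phi, tp (C `|` range b) a phi ->
    exists2 a' : I -> M, (forall i, C (a' i)) &
      sat (tcat a' (@elem M (C `|` range b))) phi.

(* In what follows [ind A C B] says that A is independent from B over C. *)
Variable ind : set M -> set M -> set M -> Prop.

Definition aut_invariant : Prop :=
  forall (A B C : set M) (s : M -> M),
    small kappa A -> small kappa B -> small kappa C -> automorphism s ->
    (ind A C B <-> ind (s @` A) (s @` C) (s @` B)).

Definition symmetry : Prop :=
  forall A B C : set M,
    small kappa A -> small kappa B -> small kappa C ->
    ind A C B -> ind B C A.

Definition full_existence : Prop :=
  forall A B C : set M,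
    small kappa A -> small kappa B -> small kappa C ->
    exists2 A' : set M, equiv_set C A' A & ind A' C B.

(* The version for tuples; applied to enumerations of sets it gives the version
   for sets. *)
Definition stationarity_over_models : Prop :=
  forall (S A : set M) (I : Type) (c1 c2 : I -> M),
    small_model S -> small kappa A -> small kappa [set: I] ->
    ind (range c1) S A -> ind (range c2) S A ->
    equiv_tuple S c1 c2 -> equiv_tuple (S `|` A) c1 c2.

Definition weak_transitivity_over_models : Prop :=
  forall (S : set M) (I J K : Type) (a : I -> M) (b : J -> M) (d : K -> M),
    small_model S ->
    small kappa [set: I] -> small kappa [set: J] -> small kappa [set: K] ->
    ind (range a) (S `|` range d) (range b) ->
    heir a S d -> coheir b S d ->
    ind (range a) S (range b).

End Independence.

(* Indiscernible over the empty set. *)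
Definition indiscernible (L : language) (M : structure L) (I : Type)
    (a : nat -> I -> M) : Prop :=
  forall (n : nat) (f g : 'I_n -> nat),
    (forall i j : 'I_n, i < j -> f i < f j) ->
    (forall i j : 'I_n, i < j -> g i < g j) ->
    tp0 (fun z : 'I_n * I => a (f z.1) z.2) =
    tp0 (fun z : 'I_n * I => a (g z.1) z.2).

(* Given p(x, y), with x and y tuples of variables indexed by [I], the union of
   the p(x_k, x_(k+1)) for k in Z/n, where x_k is indexed by [(k, _)]. *)
Definition cycle_type (L : language) (I : Type) (n : nat)
    (p : set (formula L (I + I)%type)) : set (formula L ('I_n * I)%type) :=
  \bigcup_(k in [set: 'I_n])
    rename (tcat (fun i => (k, i)) (fun i => (ordS k, i))) @` p.

Arguments cycle_type {L I} n p.

(* The n-strong order property, for n at least 3. *)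
Definition SOP (kappa : Type) (L : language) (T : set (sentence L))
    (M : structure L) (n : nat) : Prop :=
  exists (I : Type) (a : nat -> I -> M),
    [/\ small kappa [set: I],
        indiscernible a &
        ~ consistent T (cycle_type n (tp0 (tcat (a 0) (a 1))))].

Definition NSOP (kappa : Type) (L : language) (T : set (sentence L))
    (M : structure L) (n : nat) : Prop :=
  ~ SOP kappa T M n.

(* Main.v *)
Require Import Defs.
From mathcomp Require Import all_boot.
From mathcomp Require Import boolp classical_sets functions cardinality filter.

(** An indiscernible sequence (a_i) is given, with p = tp(a_0, a_1); a cycle of
    p of length four has to be found in the monster.

    Choose a small model S containing all the a_i and a nonprincipal ultrafilter
    U on nat.  Let q be the limit along U of the types of the a_i; it is a global
    type, finitely satisfiable in S.  Realize q three times in a row: b2 over S,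
    then b1 over S b2, then b0 over S b1 b2 (morley_triple).  By indiscernibility
    (b0, b1) and (b1, b2) realize p (morley_pair_tp0); moreover b0 is a coheir
    of its type over S with respect to b1, and b2 is an heir of its type over S
    with respect to b1 (morley_pair_coheir, morley_pair_heir).

    Full existence moves b2, over S b1, to some c independent from b0 over S b1;
    the properties of (b1, b2) pass to (b1, c).  Weak transitivity with b1 in the
    middle makes c independent from b0 over S.  Since b0 and c have the same type
    over S, symmetry and stationarity give an automorphism exchanging them
    (independent_swap).  Let e be the image of b1: applying this automorphism to
    (b0, b1) and (b1, c) shows that (c, e) and (e, b0) realize p, so that
    b0, b1, c, e is the required cycle.

    The tuples b0, b1, b2 are obtained at once in an ultrapower along the product
    U * U * U, where the theorem of Los computes their type (ultrapower).  A small
    elementary hull of this tuple and of S embeds into the monster by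
    universality, and homogeneity puts S back in place (limit_type_realized).
    The cardinal kappa is an arbitrary uncountable one, so the smallness of hulls
    and of concatenated tuples rests on the equality of X * X and X for infinite
    cardinals (infinite_card_prod_le). *)

Set Implicit Arguments.
Unset Strict Implicit.
Unset Printing Implicit Defensive.

Local Open Scope classical_set_scope.
Local Open Scope card_scope.

(** * Infinite cardinals *)

Lemma card_le_typeP (X Y : Type) :
  [set: X] #<= [set: Y] <-> exists f : X -> Y, injective f.
Proof.
split=> [/card_leP[f]|[f f_inj]].
  exists (fun x => \val (f (SigSub (in_setT x)))) => x y /val_inj.
  by move=> /(@inj _ _ _ f) xy; have := xy (in_setT _) (in_setT _); case.
have [g] : $|{injfun [set: X] >-> [set: Y]}|.
  by apply/injfunPex; exists f => // x y _ _ /f_inj.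
exact: inj_card_le.
Qed.

Lemma maximal_superset (Z : Type) (P : set (set Z)) (G0 : set Z) :
  P G0 ->
  (forall F : set (set Z), F `<=` P -> total_on F subset ->
     P (\bigcup_(G in F) G)) ->
  exists G, [/\ P G, G0 `<=` G & forall H, P H -> G `<=` H -> H `<=` G].
Proof.
move=> PG0 Pcup; pose Q G := P (G0 `|` G).
have [F FQ Ftot|G [QG maxG]] := @Zorn_bigcup Z Q.
  (* G0 is added to the chain so that the empty chain is covered too. *)
  rewrite /Q; pose F' := [set G0 `|` G | G in F] `|` [set G0].
  suff -> : G0 `|` \bigcup_(G in F) G = \bigcup_(G in F') G.
    apply: Pcup; first by move=> _ [[G /FQ ? <-]|->].
    move=> _ _ [[G FG <-]|->] [[H FH <-]|->].
    - by have [GH|HG] := Ftot _ _ FG FH; [left|right]; apply: setUS.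
    - by right=> z; left.
    - by left=> z; left.
    - by left.
  apply/seteqP; split=> [z [G0z|[G FG Gz]]|z [_ [[G FG <-]|->]]].
  - by exists G0 => //; right.
  - by exists (G0 `|` G); last right; first (left; exists G).
  - by move=> [?|Gz]; [left|right; exists G].
  - by left.
exists (G0 `|` G); split=> [//|z|H PH GH]; first by left.
apply: contrapT => nHG; apply: (maxG H).
  rewrite properEneq; split; last by move=> z ?; apply: GH; right.
  by apply/eqP => GH'; apply: nHG => z; rewrite -GH'; right.
rewrite /Q; suff -> : G0 `|` H = H by [].
by apply/setUidPr => z ?; apply: GH; left.
Qed.

(** Any two cardinals are comparable: a maximal graph of a partial injection
    from A to B exhausts A or B, since otherwise it could be extended by one
    pair. *)
Lemma injection_comparable (X Y : Type) (x0 : X) (y0 : Y)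
    (A : set X) (B : set Y) :
  (exists2 f : X -> Y, {homo f : x / A x >-> B x} & set_inj A f) \/
  (exists2 g : Y -> X, {homo g : y / B y >-> A y} & set_inj B g).
Proof.
pose P (G : set (X * Y)) := (forall p, G p -> A p.1 /\ B p.2) /\
  (forall p q, G p -> G q -> p.1 = q.1 <-> p.2 = q.2).
have [//|F FP Ftot|G [[GAB Gbi] _ maxG]] := @maximal_superset _ P set0.
  split=> [p [G /FP[+ _]]|p q [G FG Gp] [H FH Hq]]; first exact.
  have [GH|HG] := Ftot _ _ FG FH.
    by have [_] := FP _ FH; apply => //; apply: GH.
  by have [_] := FP _ FG; apply => //; apply: HG.
have [totA|/existsNP[x /not_implyP[Ax nx]]] :=
  pselect (forall x, A x -> exists y, G (x, y)).
  have /choice[f Gf] : forall x, exists y, A x -> G (x, y).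
    by move=> x; have [/totA[y ?]|?] := pselect (A x); [exists y|exists y0].
  left; exists f => [x /Gf/GAB[]//|x x' /set_mem Ax /set_mem Ax' fxx'].
  by apply/(Gbi _ _ (Gf _ Ax) (Gf _ Ax')).
have [totB|] := pselect (forall y, B y -> exists x, G (x, y)).
  have /choice[g Gg] : forall y, exists x, B y -> G (x, y).
    by move=> y; have [/totB[z ?]|?] := pselect (B y); [exists z|exists x0].
  right; exists g => [y /Gg/GAB[]//|y y' /set_mem By /set_mem By' gyy'].
  by apply/(Gbi _ _ (Gg _ By) (Gg _ By')).
move=> /existsNP[y /not_implyP[By ny]].
exfalso; apply: (nx); exists y; apply: (maxG (G `|` [set (x, y)])); last by right.
  split=> [p [/GAB//|->//]|p q].
  move=> [Gp|->] [Gq|->] //=; first exact: Gbi.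
    split=> e; exfalso.
      by apply: nx; exists p.2; rewrite -e -surjective_pairing.
    by apply: ny; exists p.1; rewrite -e -surjective_pairing.
  split=> e; exfalso.
    by apply: nx; exists q.2; rewrite e -surjective_pairing.
  by apply: ny; exists q.1; rewrite e -surjective_pairing.
by move=> p; left.
Qed.

(** Hessenberg's theorem.  Among the graphs of injective operations
    D * D -> D with D a subset of X, take a maximal one above an operation on a
    countable set.  If the complement of D injects into D, then X injects into
    D * D, hence into D, and the operation on D gives one on X.  Otherwise the
    complement contains a copy of D, and the operation extends to the union of
    D and this copy. *)
Lemma infinite_card_prod_le (X : Type) :
  infinite_set [set: X] -> [set: X * X] #<= [set: X].
Proof.
move=> /infiniteP /card_le_typeP[e e_inj].
(* The domain of an operation is read off the diagonal of its graph. *)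
pose D (G : set (X * X * X)) : set X := [set x | exists z, G (x, x, z)].
pose P (G : set (X * X * X)) :=
  [/\ forall p, G p -> [/\ D G p.1.1, D G p.1.2 & D G p.2],
      forall x y, D G x -> D G y -> exists z, G (x, y, z) &
      forall p q, G p -> G q -> p.1 = q.1 <-> p.2 = q.2].
have /card_le_typeP[c c_inj] : [set: nat * nat] #<= [set: nat].
  exact: countableP.
pose G0 := [set p | exists m n, p = (e m, e n, e (c (m, n)))].
have DG0 n : D G0 (e n) by exists (e (c (n, n))), n, n.
have PG0 : P G0.
  split=> [_ [m [n ->]]|x y [_ [m [_ [-> _ _]]]] [_ [n [_ [-> _ _]]]]|].
  - by split; exact: DG0.
  - by exists (e (c (m, n))), m, n.
  move=> _ _ [m [n ->]] [m' [n' ->]] /=; split; first by case=> /e_inj-> /e_inj->.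
  by move=> /e_inj/c_inj[-> ->].
have [F FP Ftot|G [[GD Gtot Gbi] G0G maxG]] := maximal_superset PG0.
  have DF G : F G -> D G `<=` D (\bigcup_(G in F) G).
    by move=> FG x [z Gz]; exists z, G.
  have cover p q : (\bigcup_(G in F) G) p -> (\bigcup_(G in F) G) q ->
      exists2 G, F G & G p /\ G q.
    move=> [G FG Gp] [H FH Hq]; have [GH|HG] := Ftot _ _ FG FH.
      by exists H => //; split=> //; apply: GH.
    by exists G => //; split=> //; apply: HG.
  split=> [p [G FG Gp]|x y [z xz] [t yt]|p q].
  - have [GD _ _] := FP _ FG; have [? ? ?] := GD _ Gp.
    by split; apply: (DF _ FG).
  - have [G FG [Gx Gy]] := cover _ _ xz yt.
    have [_ Gtot _] := FP _ FG.
    have [||w Gw] := Gtot x y; [by exists z|by exists t|by exists w, G].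
  - by move=> /cover/[apply] -[G /FP[_ _ Gbi] []]; exact: Gbi.
have Gf : exists f : X -> X -> X, forall x y, D G x -> D G y -> G (x, y, f x y).
  have /choice[f Hf] : forall p : X * X, exists z, D G p.1 -> D G p.2 -> G (p, z).
    move=> [x y] /=; have [[Dx Dy]|nD] := pselect (D G x /\ D G y).
      by have [z] := Gtot _ _ Dx Dy; exists z.
    by exists x => Dx Dy; case: nD.
  by exists (fun x y => f (x, y)) => x y; apply: (Hf (x, y)).
have {Gf}[f Gf] := Gf.
have fD x y : D G x -> D G y -> D G (f x y).
  by move=> Dx Dy; have [] := GD _ (Gf _ _ Dx Dy).
have f_inj x y x' y' : D G x -> D G y -> D G x' -> D G y' ->
    f x y = f x' y' -> x = x' /\ y = y'.
  move=> Dx Dy Dx' Dy' /(Gbi _ _ (Gf _ _ Dx Dy) (Gf _ _ Dx' Dy'))/=.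
  by case=> -> ->.
have GE p : G p -> p.2 = f p.1.1 p.1.2.
  move: p => [[x y] z] Gp; have [Dx Dy _] := GD _ Gp.
  by apply/(Gbi _ _ Gp (Gf _ _ Dx Dy)).
(* Two distinct elements of D, to serve as tags. *)
pose t (b : bool) := e b.
have Dt b : D G (t b) by have [z ?] := DG0 b; exists z; apply: G0G.
have t_inj : injective t by move=> [] [] // /e_inj.
have [[g gD g_inj]|[g gD g_inj]] :=
  injection_comparable (e 0) (e 0) (~` D G) (D G).
  apply/card_le_typeP.
  pose j x := if pselect (D G x) then f x (t true) else f (g x) (t false).
  have jD x : D G (j x).
    by rewrite /j; case: pselect => ?; apply: fD => //; apply: gD.
  have j_inj : injective j.
    move=> x y; rewrite /j; case: pselect => Dx; case: pselect => Dy E.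
    - by have [] := f_inj _ _ _ _ Dx (Dt true) Dy (Dt true) E.
    - by have [_ /t_inj] := f_inj _ _ _ _ Dx (Dt true) (gD _ Dy) (Dt false) E.
    - by have [_ /t_inj] := f_inj _ _ _ _ (gD _ Dx) (Dt false) Dy (Dt true) E.
    - have [+ _] := f_inj _ _ _ _ (gD _ Dx) (Dt false) (gD _ Dy) (Dt false) E.
      by apply: g_inj; exact: mem_set.
  exists (fun p => f (j p.1) (j p.2)) => -[x y] [x' y'] /= /f_inj[] //.
  by move=> /j_inj -> /j_inj ->.
(* An element of the union of D and its copy is coded by d in D and a tag that
   selects d itself or its twin g d.  The new pairs are sent into the copy, with
   enough tags to keep the operation injective. *)
pose val d b := if b then d else g d.
have val_inj d b d' b' : D G d -> D G d' -> val d b = val d' b' -> d = d' /\ b = b'.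
  move=> Dd Dd'; rewrite /val; case: b; case: b' => //.
  - by move=> E; case: (gD d') => //; rewrite -E.
  - by move=> E; case: (gD d) => //; rewrite E.
  - by move=> E; split=> //; apply: g_inj E; exact: mem_set.
pose h d b d' b' := if b && b' then f d d' else g (f (f d d') (f (t b) (t b'))).
pose H := [set p | exists d b d' b',
  [/\ D G d, D G d' & p = (val d b, val d' b', h d b d' b')]].
exfalso.
have Dgx : D G (e 0) by exact: (Dt false).
have GH : G `<=` H.
  move=> [[x y] z] Gp; have [Dx Dy _] := GD _ Gp.
  by exists x, true, y, true; split=> //; rewrite /h /= -[f x y](GE _ Gp).
apply: (gD (e 0)) => //.
have DH d b : D G d -> D H (val d b).
  by move=> Dd; exists (h d b d b), d, b, d, b.
have DHP x : D H x -> exists d b, D G d /\ x = val d b.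
  by move=> [z [d [b [_ [_ [Dd _ [-> _ _]]]]]]]; exists d, b.
have [z Hz] := DH (e 0) false Dgx.
suff /maxG /(_ GH _ Hz) : P H by move=> ?; exists z.
split=> [_ [d [b [d' [b' [Dd Dd' ->]]]]]|
         x y /DHP[d [b [Dd ->]]] /DHP[d' [b' [Dd' ->]]]|].
- split; try exact: DH.
  rewrite /h; case: ifP => _; first by apply: (DH _ true); apply: fD.
  by apply: (DH _ false); do 2!apply: (fD) => //.
- by exists (h d b d' b'), d, b, d', b'.
move=> _ _ [d [b [d' [b' [Dd Dd' ->]]]]] [k [a [k' [a' [Dk Dk' ->]]]]] /=.
split=> [[/val_inj[] // -> -> /val_inj[] // -> ->] //|].
have D3 x y r r' : D G x -> D G y -> D G (f (f x y) (f (t r) (t r'))).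
  by move=> ? ?; do 2!apply: (fD) => //.
rewrite /h; case: ifP => [/andP[-> ->]|_]; case: ifP => [/andP[-> ->]|_].
- by move=> E; have [-> ->] := f_inj _ _ _ _ Dd Dd' Dk Dk' E.
- by move=> E; exfalso; apply: (gD _ (D3 k k' a a' Dk Dk')); rewrite -E; apply: fD.
- by move=> E; exfalso; apply: (gD _ (D3 d d' b b' Dd Dd')); rewrite E; apply: fD.
- move=> /g_inj E.
  have {}E := E (mem_set (D3 _ _ _ _ Dd Dd')) (mem_set (D3 _ _ _ _ Dk Dk')).
  have [E1 E2] := f_inj _ _ _ _ (fD _ _ Dd Dd') (fD _ _ (Dt _) (Dt _))
    (fD _ _ Dk Dk') (fD _ _ (Dt _) (Dt _)) E.
  have [-> ->] := f_inj _ _ _ _ Dd Dd' Dk Dk' E1.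
  by have [/t_inj -> /t_inj ->] := f_inj _ _ _ _ (Dt _) (Dt _) (Dt _) (Dt _) E2.
Qed.

(** * Small sets *)

Lemma infinite_card_seq_le (X : Type) :
  infinite_set [set: X] -> [set: seq X] #<= [set: X].
Proof.
move=> Xinf; have /infiniteP /card_le_typeP[e e_inj] := Xinf.
have /card_le_typeP[f f_inj] := infinite_card_prod_le Xinf.
pose code := foldr (fun x c => f (x, c)) (e 0).
apply/card_le_typeP; exists (fun s => f (e (size s), code s)) => s t.
move=> /f_inj[/e_inj]; elim: s t => [|x s IHs] [|y t] //= [/IHs IH].
by move=> /f_inj[-> /IH ->].
Qed.

Section Small.
Variable kappa : Type.
Hypothesis kappa_uncountable : ~ countable [set: kappa].

Lemma small_card_le (X Y : Type) (A : set X) (B : set Y) :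
  A #<= B -> small kappa B -> small kappa A.
Proof.
move=> AB [Bk kB]; split; first exact: card_le_trans AB Bk.
by move=> kA; apply: kB; apply: card_le_trans kA AB.
Qed.

Lemma small_inj (X Y : Type) (f : X -> Y) :
  injective f -> small kappa [set: Y] -> small kappa [set: X].
Proof. by move=> f_inj; apply: small_card_le; apply/card_le_typeP; exists f. Qed.

Lemma small_elem (X : Type) (A : set X) :
  small kappa A -> small kappa [set: A].
Proof.
by apply: small_card_le; have := card_setT A; rewrite card_eq_le => /andP[].
Qed.

Lemma small_sub (X : Type) (A B : set X) :
  A `<=` B -> small kappa B -> small kappa A.
Proof. by move=> AB; apply: small_card_le; exact: subset_card_le. Qed.

Lemma small_range (X I : Type) (a : I -> X) :
  small kappa [set: I] -> small kappa (range a).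
Proof. by apply: small_card_le; exact: card_image_le. Qed.

Lemma infinite_kappa : infinite_set [set: kappa].
Proof. by move=> /finite_set_countable. Qed.

Lemma small_countable (X : Type) (A : set X) : countable A -> small kappa A.
Proof.
move=> Ac; split.
  by apply: card_le_trans Ac _; apply/infiniteP; exact: infinite_kappa.
by move=> kA; apply: kappa_uncountable; exact: card_le_trans kA Ac.
Qed.

(** If kappa injected into X + Y, then so would kappa * kappa; either some row
    of this square lands in X, or every row meets Y, so that kappa injects into
    X or into Y. *)
Lemma small_sum (X Y : Type) :
  small kappa [set: X] -> small kappa [set: Y] -> small kappa [set: X + Y].
Proof.
move=> [/card_le_typeP[f f_inj] kX] [/card_le_typeP[g g_inj] kY].
have /infiniteP /card_le_typeP[e e_inj] := infinite_kappa.
have /card_le_typeP[c c_inj] := infinite_card_prod_le infinite_kappa.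
split; apply/card_le_typeP.
  exists (fun z => match z with
                   | inl x => c (e 0, f x)
                   | inr y => c (e 1, g y)
                   end).
  move=> [x|y] [x'|y'] /c_inj[]; try by move=> /e_inj.
    by move=> /f_inj ->.
  by move=> /g_inj ->.
move=> [h h_inj].
have [[k hk]|nk] := pselect (exists k, forall l, exists x, h (c (k, l)) = inl x).
  apply: kX; have /choice[x hx] := hk; apply/card_le_typeP.
  exists x => l l' xl.
  by have /h_inj/c_inj[] : h (c (k, l)) = h (c (k, l')) by rewrite !hx xl.
have /choice[y hy] : forall k, exists y, exists l, h (c (k, l)) = inr y.
  move=> k; apply: contrapT => nl; apply: nk; exists k => l.
  case E : (h (c (k, l))) => [x|y]; first by exists x.
  by case: nl; exists y, l.
apply: kY; apply/card_le_typeP; exists y => k k' yk.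
have [[l hl] [l' hl']] := (hy k, hy k').
by have /h_inj/c_inj[] : h (c (k, l)) = h (c (k', l')) by rewrite hl hl' yk.
Qed.

Lemma small_setU (X : Type) (A B : set X) :
  small kappa A -> small kappa B -> small kappa (A `|` B).
Proof.
move=> /small_elem As /small_elem Bs.
apply: small_sub (small_range (tcat (@elem X A) (@elem X B)) (small_sum As Bs)).
move=> x [Ax|Bx]; first by exists (inl (SigSub (mem_set Ax))).
by exists (inr (SigSub (mem_set Bx))).
Qed.

Lemma small_seq (X : Type) :
  small kappa [set: X] -> small kappa [set: seq X].
Proof.
move=> Xs; pose Y := (nat + X)%type.
have Ys : small kappa [set: Y].
  by apply: small_sum => //; apply: small_countable; exact: countableP.
apply: (@small_inj _ (seq Y) (map inr)); first by apply: inj_map => x y [].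
apply: small_card_le Ys; apply: infinite_card_seq_le.
by apply/infiniteP/card_le_typeP; exists inl => x y [].
Qed.

Lemma small_prod (X Y : Type) :
  small kappa [set: X] -> small kappa [set: Y] -> small kappa [set: X * Y].
Proof.
move=> Xs Ys; pose f (p : X * Y) : seq (X + Y) := [:: inl p.1; inr p.2].
apply: (@small_inj _ _ f); last exact: small_seq (small_sum Xs Ys).
by move=> [x y] [x' y'] [-> ->].
Qed.

End Small.

(** * Formulas, substitution and automorphisms *)

Definition scons (X V : Type) (x : X) (v : V -> X) (z : option V) : X :=
  if z is Some y then v y else x.

Section Substitution.
Variable L : language.

Lemma eval_rename (M : structure L) (V W : Type) (h : V -> W) (v : W -> M)
    (t : term L V) :
  eval v (trename h t) = eval (v \o h) t.
Proof. by elim: t => //= f ts IH; congr fint; apply/funext. Qed.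

Lemma scons_omap (X V W : Type) (x : X) (h : V -> W) (v : W -> X) :
  scons x v \o omap h = scons x (v \o h).
Proof. by apply/funext => -[]. Qed.

Lemma sat_rename (M : structure L) (V W : Type) (h : V -> W) (v : W -> M)
    (phi : formula L V) :
  sat v (rename h phi) <-> sat (v \o h) phi.
Proof.
elim: phi W h v => {V} [V|V t u|V r ts|V phi1 IH1 phi2 IH2|V phi IH] W h v //=.
- by rewrite !eval_rename.
- by under eq_fun do rewrite eval_rename.
- by split=> H /IH1 /H /IH2.
- have E x :
      sat (scons x v) (rename (omap h) phi) <-> sat (scons x (v \o h)) phi.
    by rewrite IH scons_omap.
  by split=> H x; apply/E; apply: H.
Qed.

(** Elementarity for formulas with an arbitrary type of variables; it agrees
    with elementary embeddings because a formula mentions finitely many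
    variables (elementary_embedding_sat). *)
Definition sat_preserving (N M : structure L) (e : N -> M) : Prop :=
  forall (V : Type) (v : V -> N) (phi : formula L V),
    sat v phi <-> sat (e \o v) phi.

Lemma automorphism_sat (M : structure L) (s : M -> M) :
  automorphism s -> sat_preserving s.
Proof.
move=> [[s' sK s'K] sf sr] V v phi.
have es U (u : U -> M) t : s (eval u t) = eval (s \o u) t.
  by elim: t => //= f ts IH; rewrite sf; congr fint; apply/funext.
elim: phi v => {V} [V|V t u|V r ts|V phi1 IH1 phi2 IH2|V phi IH] v //=.
- by rewrite -!es; split=> [->//|/(can_inj sK)].
- rewrite sr.
  suff -> : s \o (fun i => eval v (ts i)) = fun i => eval (s \o v) (ts i) by [].
  by apply/funext => i /=.
- by split=> H /(IH1 v) /H /(IH2 v).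
- have E x : sat (scons x v) phi <-> sat (scons (s x) (s \o v)) phi.
    rewrite IH; suff -> : s \o scons x v = scons (s x) (s \o v) by [].
    by apply/funext => -[].
  split=> H x; last by apply/E; apply: H.
  by rewrite -[x]s'K; apply/E; apply: H.
Qed.

Lemma automorphism_comp (M : structure L) (s t : M -> M) :
  automorphism s -> automorphism t -> automorphism (s \o t).
Proof.
move=> [sb sf sr] [tb tf tr]; split; first exact: bij_comp.
  by move=> f v /=; rewrite tf sf.
by move=> r v; rewrite tr sr.
Qed.

Lemma automorphism_inv (M : structure L) (s : M -> M) :
  automorphism s -> exists s', [/\ automorphism s', cancel s s' & cancel s' s].
Proof.
move=> [[s' sK s'K] sf sr]; exists s'; split=> //; split; first by exists s.
  move=> f v; apply: (can_inj sK); rewrite s'K sf; congr fint.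
  by apply/funext => i /=; rewrite s'K.
move=> r v; rewrite (sr _ (s' \o v)); suff -> : s \o (s' \o v) = v by [].
by apply/funext => i /=; rewrite s'K.
Qed.

Fixpoint toccurs (V : Type) (t : term L V) (x : V) : Prop :=
  match t with
  | Var y => y = x
  | App f ts => exists i, toccurs (ts i) x
  end.

Fixpoint occurs (V : Type) (phi : formula L V) : set V :=
  match phi with
  | Bot => set0
  | Eqt t u => toccurs t `|` toccurs u
  | Rel r ts => \bigcup_i toccurs (ts i)
  | Imp phi1 phi2 => occurs phi1 `|` occurs phi2
  | All phi1 => Some @^-1` occurs phi1
  end.

Lemma eval_occurs (M : structure L) (V : Type) (v w : V -> M) (t : term L V) :
  (forall x, toccurs t x -> v x = w x) -> eval v t = eval w t.
Proof.
elim: t => /= [x|f ts IH] vw; first exact: vw.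
by congr fint; apply/funext => i; apply: IH => x tx; apply: vw; exists i.
Qed.

Lemma sat_occurs (M : structure L) (V : Type) (v w : V -> M)
    (phi : formula L V) :
  (forall x, occurs phi x -> v x = w x) -> sat v phi <-> sat w phi.
Proof.
elim: phi v w => {V} [V|V t u|V r ts|V phi1 IH1 phi2 IH2|V phi IH] v w //= vw.
- have -> : eval v t = eval w t by apply: eval_occurs => x ?; apply: vw; left.
  have -> // : eval v u = eval w u.
  by apply: eval_occurs => x ?; apply: vw; right.
- suff -> : (fun i => eval v (ts i)) = fun i => eval w (ts i) by [].
  by apply/funext => i; apply: eval_occurs => x tx; apply: vw; exists i.
- have {}IH1 : sat v phi1 <-> sat w phi1 by apply: IH1 => x ?; apply: vw; left.
  have {}IH2 : sat v phi2 <-> sat w phi2 by apply: IH2 => x ?; apply: vw; right.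
  by split=> H /IH1 /H /IH2.
- have E x : sat (scons x v) phi <-> sat (scons x w) phi.
    by apply: IH => -[y|] //= oy; apply: vw.
  by split=> H x; apply/E; apply: H.
Qed.

Lemma toccurs_finite (V : Type) (t : term L V) : finite_set (toccurs t).
Proof.
elim: t => [x|f ts IH].
  by apply: sub_finite_set (finite_set1 x) => y /= ->.
apply: (@sub_finite_set _ _ (\bigcup_i toccurs (ts i))).
  by move=> y [i]; exists i.
by apply: bigcup_finite => [|i _]; [exact: finite_finset|exact: IH].
Qed.

Lemma occurs_finite (V : Type) (phi : formula L V) : finite_set (occurs phi).
Proof.
elim: phi => {V} [V|V t u|V r ts|V phi1 IH1 phi2 IH2|V phi IH] /=.
- exact: finite_set0.
- by rewrite finite_setU; split; apply: toccurs_finite.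
- by apply: bigcup_finite => [|i _]; [exact: finite_finset|exact: toccurs_finite].
- by rewrite finite_setU.
- have : finite_set (Some @` (Some @^-1` occurs phi)).
    by apply: sub_finite_set IH => _ [x ? <-].
  by rewrite (eq_finite_set (inj_card_eq _)) //; move=> x y _ _ [].
Qed.

(** The type V may be infinite and may be empty, whence a renaming g into a
    nonempty ordinal with a partial inverse h: a valuation v of V can be replaced
    by the valuation i |-> v (h i), completed by a default value, of finitely
    many variables. *)
Lemma finitely_many_variables (V : Type) (phi : formula L V) :
  exists (n : nat) (g : V -> 'I_n.+1) (h : 'I_n.+1 -> option V),
    forall x, occurs phi x -> h (g x) = Some x.
Proof.
have /finite_set_leP[n /pcard_leP[g]] := occurs_finite phi.
exists n, (fun x => inord (g x)).
pose Q (i : 'I_n.+1) x := occurs phi x /\ g x = i.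
have /choice[h hQ] : forall i, exists z : option V,
    forall x, Q i x -> z = Some x.
  move=> i; have [[x [ox gx]]|nQ] := pselect (exists x, Q i x).
    exists (Some x) => y [oy gy]; congr Some.
    apply: (@inj _ _ _ g); [exact: mem_set|exact: mem_set|].
    exact: etrans gx (esym gy).
  by exists None => x Qx; case: nQ; exists x.
exists h => x ox; apply: hQ; split=> //; rewrite inordK //.
by have := @funS _ _ _ _ g x ox; rewrite /= => /ltnW.
Qed.

Lemma elementary_embedding_sat (N M : structure L) (e : N -> M) :
  elementary_embedding e -> sat_preserving e.
Proof.
move=> ee V v phi; have [n [g [h hg]]] := finitely_many_variables phi.
have [x0] := carrier_inhabited N.
pose w i := if h i is Some x then v x else x0.
have wg x : occurs phi x -> v x = w (g x) by rewrite /w => /hg ->.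
have : sat w (rename g phi) <-> sat (e \o w) (rename g phi) by apply: ee.
rewrite !sat_rename.
rewrite (@sat_occurs _ _ v (w \o g)) //.
by rewrite (@sat_occurs _ _ (e \o v) ((e \o w) \o g)) // => x ox /=; rewrite wg.
Qed.

Lemma sat_preserving_models (T : set (sentence L)) (N M : structure L)
    (e : N -> M) :
  sat_preserving e -> models T N <-> models T M.
Proof.
have E : e \o of_void N = of_void M by apply/funext => -[].
by move=> ee; split=> NT phi /NT; rewrite (ee _ (of_void N)) E.
Qed.

End Substitution.

Section Counting.
Variable L : language.
Hypothesis L_countable : countable_language L.

(** Formulas are coded injectively by finitely branching trees with labels in
    nat; under a quantifier the bound variable gets the code 0 and the others
    are shifted. *)
Lemma formula_countable (V : Type) :
  countable [set: V] -> countable [set: formula L V].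
Proof.
have [/card_le_typeP[cf cf_inj] /card_le_typeP[cr cr_inj]] := L_countable.
move=> /card_le_typeP[g0 g0_inj].
pose fix tcode U (g : U -> nat) (t : term L U) : GenTree.tree nat :=
  match t with
  | Var x => GenTree.Leaf (g x)
  | App f ts => GenTree.Node (cf f)
      [seq tcode U g (ts i) | i <- enum 'I_(farity f)]
  end.
pose fix code U (g : U -> nat) (phi : formula L U) : GenTree.tree nat :=
  match phi with
  | Bot => GenTree.Node 0 [::]
  | Eqt t u => GenTree.Node 1 [:: tcode U g t; tcode U g u]
  | Rel r ts => GenTree.Node 2
      (GenTree.Leaf (cr r) :: [seq tcode U g (ts i) | i <- enum 'I_(rarity r)])
  | Imp phi1 phi2 => GenTree.Node 3 [:: code U g phi1; code U g phi2]
  | All phi1 => GenTree.Node 4 [:: code _ (scons 0 (S \o g)) phi1]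
  end.
have map_inj k (F G : 'I_k -> GenTree.tree nat) :
    [seq F i | i <- enum 'I_k] = [seq G i | i <- enum 'I_k] -> F =1 G.
  by move=> /eq_in_map FG i; apply: FG; rewrite mem_enum.
have tcode_inj U (g : U -> nat) : injective g -> injective (tcode U g).
  move=> g_inj; elim=> [x|f ts IH] [y|f' us] //=; first by move=> [/g_inj ->].
  move=> [/cf_inj E]; case: f' / E us => us /map_inj tu.
  by congr App; apply/funext => i; apply: IH; exact: tu.
have code_inj U (g : U -> nat) : injective g -> injective (code U g).
  move=> g_inj phi; elim: phi g g_inj =>
    {U} [U|U t u|U r ts|U phi1 IH1 phi2 IH2|U phi IH] g g_inj
    [|t' u'|r' ts'|phi1' phi2'|phi'] //=.
  - by move=> [/tcode_inj -> // /tcode_inj ->].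
  - move=> [/cr_inj E]; case: r' / E ts' => ts' /map_inj tt.
    by congr Rel; apply/funext => i; apply: (tcode_inj _ _ g_inj); exact: tt.
  - by move=> [/IH1 -> // /IH2 ->].
  - move=> [/IH -> //] [x|] [y|] //= [/g_inj ->] //.
apply: (@card_le_trans _ _ _ [set: GenTree.tree nat]).
  by apply/card_le_typeP; exists (code V g0); apply: code_inj.
exact: countableP.
Qed.

End Counting.

(** * Elementary hulls *)

Lemma sval_inj (X : Type) (A : X -> Prop) : injective (@sval X A).
Proof. by move=> [x ?] [y ?] /= xy; exact: eq_exist. Qed.

Section TarskiVaught.
Variables (L : language) (N : structure L).

Definition has_witnesses (A : set N) : Prop :=
  forall (V : Type) (phi : formula L (option V)) (v : V -> N),
    (forall i, A (v i)) -> (exists x, sat (scons x v) phi) ->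
    exists2 x, A x & sat (scons x v) phi.

(** The Tarski-Vaught test.  The witness property yields closure under the
    function symbols (applied to the formula x = f(v)), nonemptiness, and the
    quantifier step of the induction. *)
Lemma tarski_vaught (A : set N) :
  has_witnesses A ->
  exists (N' : structure L) (e : N' -> N),
    [/\ sat_preserving e, injective e & range e = A].
Proof.
move=> Aw.
have Af f (u : 'I_(farity f) -> {x | A x}) : A (fint (sval \o u)).
  pose phi : formula L (option 'I_(farity f)) :=
    Eqt (Var L None) (App (fun i => Var L (Some i))).
  have [| |x Ax /= <- //] := Aw _ phi (sval \o u); first by move=> i; apply: svalP.
  by exists (fint (sval \o u)).
have A0 : inhabited {x | A x}.
  have [x0] := carrier_inhabited N.
  have [| |x Ax _] := Aw _ (Not Bot) (of_void N) => //; first by exists x0.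
  by apply: inhabits; exists x.
pose N' := @Structure L {x | A x} A0 (fun f u => exist _ _ (Af f u))
  (fun r u => rint (sval \o u)).
exists N', sval; split=> [V v phi||].
- have es U (u : U -> N') t : sval (eval u t) = eval (sval \o u) t.
    by elim: t => //= f ts IH; congr fint; apply/funext.
  elim: phi v => {V} [V|V t u|V r ts|V phi1 IH1 phi2 IH2|V phi IH] v //=.
  + by rewrite -!es; split=> [->//|/sval_inj].
  + suff -> : sval \o (fun i => eval v (ts i)) =
        fun i => eval (sval \o v) (ts i) by [].
    by apply/funext => i /=.
  + by split=> H /(IH1 v) /H /(IH2 v).
  + have E x : sat (scons x v) phi <-> sat (scons (sval x) (sval \o v)) phi.
      rewrite IH; suff -> : sval \o scons x v = scons (sval x) (sval \o v) by [].
      by apply/funext => -[].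
    split=> H x; last by apply/E; apply: H.
    apply: contrapT => nx.
    have [| |y Ay ny] := Aw _ (Not phi) (sval \o v).
    * by move=> i; apply: svalP.
    * by exists x.
    * by apply: ny; apply/(E (exist _ y Ay)); apply: H.
- exact: sval_inj.
- apply/seteqP; split=> [_ [x _ <-]|x Ax]; first exact: svalP.
  by exists (exist _ x Ax).
Qed.

End TarskiVaught.

Section LowenheimSkolem.
Variables (kappa : Type) (L : language).
Hypothesis kappa_uncountable : ~ countable [set: kappa].
Hypothesis L_countable : countable_language L.

(** The elementary hull of a family a is the set of values of Skolem terms,
    represented as trees: a leaf is a member of the family, and a node labelled
    by the code of a formula is a chosen witness for it with the values of the
    subtrees as parameters.  Counting these trees shows that the hull is
    small. *)
Lemma lowenheim_skolem (N : structure L) (X : Type) (a : X -> N) :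
  small kappa [set: X] ->
  exists (N' : structure L) (e : N' -> N),
    [/\ small kappa [set: N'], sat_preserving e, small kappa (range e) &
        range a `<=` range e].
Proof.
move=> Xs; have [n0] := carrier_inhabited N.
have /card_le_typeP[c c_inj] : [set: formula L (option nat)] #<= [set: nat].
  by apply: formula_countable => //; exact: countableP.
have /choice[dec decK] : forall k, exists phi, forall psi, c psi = k -> psi = phi.
  move=> k; have [[psi <-]|nk] := pselect (exists psi, c psi = k).
    by exists psi => psi' /c_inj.
  by exists Bot => psi ck; case: nk; exists psi.
have /choice[wit witP] : forall p : formula L (option nat) * (nat -> N),
    exists x, (exists y, sat (scons y p.2) p.1) -> sat (scons x p.2) p.1.
  move=> p; have [[y py]|np] := pselect (exists y, sat (scons y p.2) p.1).
    by exists y.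
  by exists n0 => /np.
pose fix heval (t : GenTree.tree X) : N :=
  match t with
  | GenTree.Leaf x => a x
  | GenTree.Node k ts => wit (dec k, nth n0 (map heval ts))
  end.
have hullw : has_witnesses (range heval).
  move=> V phi v hv; have /choice[t ht] : forall i, exists t, heval t = v i.
    by move=> i; have [t _ <-] := hv i; exists t.
  have [n [g [h hg]]] := finitely_many_variables (All phi).
  pose psi := rename (omap (@nat_of_ord n.+1 \o g)) phi.
  pose ts := mkseq (fun i => if h (inord i) is Some x then t x
                             else GenTree.Node 0 [::]) n.+1.
  pose w := nth n0 (map heval ts).
  have E x : sat (scons x v) phi <-> sat (scons x w) psi.
    rewrite sat_rename scons_omap; apply: sat_occurs => -[y|] //= oy.
    rewrite /w (nth_map (GenTree.Node 0 [::])) ?size_mkseq ?ltn_ord //.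
    by rewrite nth_mkseq ?ltn_ord // inord_val hg // ht.
  move=> [x /E phix]; exists (heval (GenTree.Node (c psi) ts)).
    by exists (GenTree.Node (c psi) ts).
  apply/E; rewrite /heval -/heval -(decK _ psi) //.
  by apply: (witP (psi, w)); exists x.
have [N' [e [esat e_inj erange]]] := tarski_vaught hullw.
have trees : small kappa [set: GenTree.tree X].
  apply: (small_inj (pcan_inj (@GenTree.codeK X))).
  apply: small_seq => //; apply: small_sum => //.
  by apply: small_countable => //; exact: countableP.
have es : small kappa (range e) by rewrite erange; exact: small_range.
exists N', e; split=> //; last first.
  by rewrite erange => _ [x _ <-]; exists (GenTree.Leaf x).
apply: small_card_le es.
have := inj_card_eq (in2W e_inj : {in [set: N'] &, injective e}).
by rewrite card_eq_sym card_eq_le => /andP[].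
Qed.

End LowenheimSkolem.

(** * Ultrapowers *)

(** An ultrafilter on J, seen as the quantifier stating that almost all j
    satisfy P.  Commuting with implication packs closure under intersections and
    supersets and the ultra property into one equivalence, which is the
    implication case of the theorem of Los. *)
Definition ultra_quantifier (J : Type) (W : (J -> Prop) -> Prop) : Prop :=
  [/\ W (fun=> True), ~ W (fun=> False) &
      forall P Q, W (fun j => P j -> Q j) <-> (W P -> W Q)].

Section UltraQuantifier.
Variables (J : Type) (W : (J -> Prop) -> Prop).
Hypothesis W_ultra : ultra_quantifier W.

Lemma ultra_all (P : J -> Prop) : (forall j, P j) -> W P.
Proof.
have [WT _ _] := W_ultra => allP.
by suff -> : P = fun=> True by []; apply/funext => j; apply/propext.
Qed.

Lemma ultra_mono (P Q : J -> Prop) : (forall j, P j -> Q j) -> W P -> W Q.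
Proof. by have [_ _ WI] := W_ultra => /ultra_all/WI. Qed.

Lemma ultra_not (P : J -> Prop) : W (fun j => ~ P j) <-> ~ W P.
Proof. by have [_ WF WI] := W_ultra; rewrite WI; split=> nP // /nP. Qed.

Lemma ultra_and (P Q : J -> Prop) : W P -> W Q -> W (fun j => P j /\ Q j).
Proof.
have [_ _ WI] := W_ultra => WP; apply/WI.
by apply: ultra_mono WP => j ? ?.
Qed.

Lemma ultra_iff (P Q : J -> Prop) : W (fun j => P j <-> Q j) -> W P <-> W Q.
Proof.
have [_ _ WI] := W_ultra => PQ.
by split; apply/WI; apply: ultra_mono PQ => j [].
Qed.

Lemma ultra_ex (P : J -> Prop) : W P -> exists j, P j.
Proof.
have [_ WF _] := W_ultra => WP; apply: contrapT => nP; apply: WF.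
by apply: ultra_mono WP => j Pj; apply: nP; exists j.
Qed.

Lemma ultra_const (P : Prop) : W (fun=> P) <-> P.
Proof. by split=> [/ultra_ex[]|? ] //; apply: ultra_all. Qed.

Lemma ultra_forall_ord n (P : 'I_n -> J -> Prop) :
  (forall i, W (P i)) -> W (fun j => forall i, P i j).
Proof.
elim: n P => [|n IHn] P WP; first by apply: ultra_all => j [].
have W0 := ultra_and (WP ord0) (IHn _ (fun i => WP (lift ord0 i))).
by apply: ultra_mono W0 => j [P0 PS] i; case: (unliftP ord0 i) => [k|] ->.
Qed.

End UltraQuantifier.

(** Iterating the quantifiers is the product of ultrafilters. *)
Lemma ultra_iter (J K : Type) (U : (J -> Prop) -> Prop) (W : (K -> Prop) -> Prop) :
  ultra_quantifier U -> ultra_quantifier W ->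
  ultra_quantifier (fun P : J * K -> Prop => U (fun j => W (fun k => P (j, k)))).
Proof.
move=> uU uW; split; first by do 2![apply: ultra_all => // ?].
  by move=> /(ultra_ex uU)[j /(ultra_ex uW)[]].
move=> P Q; have [_ _ UI] := uU; have [_ _ WI] := uW.
rewrite -UI; apply: ultra_iff => //; apply: ultra_all => // j.
Qed.

Lemma nonprincipal_ultra_quantifier :
  exists2 U : (nat -> Prop) -> Prop, ultra_quantifier U &
    forall n, U (fun i => n < i).
Proof.
pose F : set_system nat := [set A | exists n, forall i, n < i -> A i].
have Fproper : ProperFilter F.
  split; first by move=> [n /(_ n.+1 (ltnSn n))].
  split; first by exists 0.
    move=> A B [m Am] [n Bn]; exists (maxn m n) => i.
    by rewrite gtn_max => /andP[/Am ? /Bn].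
  by move=> A B AB [n An]; exists n => i /An/AB.
have [G [Gultra FG]] := ultraFilterLemma Fproper.
exists (fun P => G [set i | P i]) => [|n]; last by apply: FG; exists n.
split; first exact: filterT.
  exact: filter_not_empty.
move=> P Q; split=> [PQ WP|WPQ].
  by apply: filterS (filterI PQ WP) => i [/[apply]].
have [GP|GnP] := in_ultra_setVsetC [set i | P i] Gultra.
  by apply: filterS (WPQ GP) => i Qi _.
by apply: filterS GnP => i nPi /nPi.
Qed.

(** The theorem of Los.  The map cl sends a J-indexed family to its class; the
    ultrapower consists of chosen representatives of the classes. *)
Lemma ultrapower (L : language) (M : structure L) (J : Type)
    (W : (J -> Prop) -> Prop) :
  ultra_quantifier W ->
  exists (N : structure L) (cl : (J -> M) -> N),
    forall (V : Type) (c : V -> J -> M) (phi : formula L V),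
      sat (cl \o c) phi <-> W (fun j => sat (c^~ j) phi).
Proof.
move=> uW; have [m0] := carrier_inhabited M.
pose eqW (f g : J -> M) := W (fun j => f j = g j).
have eqW_refl f : eqW f f by apply: ultra_all.
have eqW_sym f g : eqW f g -> eqW g f by apply: ultra_mono => // j.
have eqW_trans f g h : eqW f g -> eqW g h -> eqW f h.
  by move=> fg gh; apply: ultra_mono (ultra_and uW fg gh) => // j [-> ->].
have /choice[pick pickP] : forall A : set (J -> M), exists f, A !=set0 -> A f.
  move=> A; have [[f Af]|A0] := pselect (A !=set0); first by exists f.
  by exists (fun=> m0) => /A0.
pose rep f := pick (eqW f).
have eqW_rep f : eqW f (rep f) by apply: (pickP (eqW f)); exists f.
have rep_eqW f g : eqW f g -> rep f = rep g.
  move=> fg; congr pick; apply/seteqP; split=> h; last exact: eqW_trans.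
  by apply: eqW_trans; exact: eqW_sym.
pose N0 := {f | rep f = f}.
have cl0 f : rep (rep f) = rep f by apply/esym/rep_eqW/eqW_rep.
pose cl f : N0 := exist _ (rep f) (cl0 f).
pose N := @Structure L N0 (inhabits (cl (fun=> m0)))
  (fun f u => cl (fun j => fint (fun i => sval (u i) j)))
  (fun r u => W (fun j => rint (fun i => sval (u i) j))).
have evalN V (v : V -> N) t :
    W (fun j => sval (eval v t) j = eval (fun x => sval (v x) j) t).
  elim: t => [x|f ts IH] /=; first exact: ultra_all.
  pose u j := fint (fun i => sval (eval v (ts i)) j).
  have uE := ultra_and uW (ultra_forall_ord uW IH) (eqW_sym _ _ (eqW_rep u)).
  apply: ultra_mono uE => // j [E ->].
  by rewrite /u; congr fint; apply/funext => i.
have losN V (v : V -> N) phi :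
    sat v phi <-> W (fun j => sat (fun x => sval (v x) j) phi).
  have [_ WF WI] := uW.
  elim: phi v => {V} [V|V t u|V r ts|V phi1 IH1 phi2 IH2|V phi IH] v //=.
  - have <- : W (fun j => sval (eval v t) j = sval (eval v u) j) <->
        W (fun j => eval (fun x => sval (v x) j) t =
                    eval (fun x => sval (v x) j) u).
      apply: ultra_iff => //.
      have uE := ultra_and uW (evalN _ v t) (evalN _ v u).
      by apply: ultra_mono uE => // j [-> ->].
    split=> [->|tu]; first exact: ultra_all.
    apply: sval_inj; rewrite -(svalP (eval v t)) -(svalP (eval v u)).
    exact: rep_eqW.
  - apply: ultra_iff => //.
    apply: ultra_mono (ultra_forall_ord uW (fun i => evalN _ v (ts i))) => // j E.
    suff -> : (fun i => sval (eval v (ts i)) j) =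
              (fun i => eval (fun x => sval (v x) j) (ts i)) by [].
    by apply/funext => i.
  - by rewrite IH1 IH2 -WI.
  - have E (x : N) : sat (scons x v) phi <->
        W (fun j => sat (scons (sval x j) (fun y => sval (v y) j)) phi).
      rewrite IH; apply: ultra_iff => //; apply: ultra_all => // j.
      suff -> : (fun z => sval (scons x v z) j) =
          scons (sval x j) (fun y => sval (v y) j) by [].
      by apply/funext => -[].
    split=> [H|H x]; last by apply/E; apply: ultra_mono H => // j; apply.
    (* The class of a family of counterexamples refutes H. *)
    apply: contrapT => /(ultra_not uW) nH.
    have /choice[f fP] : forall j, exists x,
        ~ (forall x, sat (scons x (fun y => sval (v y) j)) phi) ->
        ~ sat (scons x (fun y => sval (v y) j)) phi.
      move=> j.
      have [A|/existsNP[x nx]] :=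
          pselect (forall x, sat (scons x (fun y => sval (v y) j)) phi).
        by exists m0.
      by exists x.
    have /E := H (cl f); apply/(ultra_not uW).
    apply: ultra_mono (ultra_and uW nH (eqW_rep f)) => // j [/fP + fj] /=.
    by rewrite -fj.
exists N, cl => V c phi; rewrite losN; apply: ultra_iff => //.
have [n [g [h hg]]] := finitely_many_variables phi.
have E : W (fun j => forall i : 'I_n.+1,
    if h i is Some x then c x j = rep (c x) j else True).
  apply: (ultra_forall_ord uW) => i.
  by case: (h i) => [x|]; [exact: eqW_rep|exact: ultra_all].
apply: ultra_mono E => // j E; apply: sat_occurs => x ox.
by have := E (g x); rewrite hg //= => ->.
Qed.

(** * Types in the monster *)

Lemma ultrapower_models (L : language) (T : set (sentence L)) (M N : structure L)
    (J : Type) (W : (J -> Prop) -> Prop) (cl : (J -> M) -> N) :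
  ultra_quantifier W ->
  (forall (V : Type) (c : V -> J -> M) (phi : formula L V),
      sat (cl \o c) phi <-> W (fun j => sat (c^~ j) phi)) ->
  models T M -> models T N.
Proof.
move=> uW los MT phi Tphi.
have -> : of_void N = cl \o of_void (J -> M) by apply/funext => -[].
apply/los; apply: ultra_all => // j.
have -> : (of_void (J -> M))^~ j = of_void M by apply/funext => -[].
exact: MT.
Qed.

Lemma tcat_comp (X Y I J : Type) (s : X -> Y) (a : I -> X) (b : J -> X) :
  s \o tcat a b = tcat (s \o a) (s \o b).
Proof. by apply/funext => -[]. Qed.

Lemma tp0P (L : language) (M N : structure L) (I : Type) (a : I -> M)
    (b : I -> N) :
  tp0 a = tp0 b <-> forall phi, sat a phi <-> sat b phi.
Proof.
split=> [ab phi|ab]; first by rewrite -[sat a phi]/(tp0 a phi) ab.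
by apply/seteqP; split=> phi /ab.
Qed.

Section Monster.
Variables (L : language) (T : set (sentence L)) (kappa : Type) (M : structure L).
Hypothesis L_countable : countable_language L.
Hypothesis kappa_uncountable : ~ countable [set: kappa].
Hypothesis M_monster : monster kappa T M.

(** An elementary hull of the tuple has size at most kappa, so it embeds
    elementarily into the monster. *)
Lemma small_tuple_realized (N : structure L) (X : Type) (a : X -> N) :
  models T N -> small kappa [set: X] -> exists d : X -> M, tp0 d = tp0 a.
Proof.
have [_ universal _ _] := M_monster.
move=> NT /(lowenheim_skolem kappa_uncountable L_countable a).
move=> [N' [e [[N'k _] esat _ ae]]].
have N'T := (sat_preserving_models T esat).2 NT.
have [e' /elementary_embedding_sat e'sat] := universal N' N'T N'k.
have /choice[y ey] : forall x, exists y, e y = a x.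
  by move=> x; have [|y _ <-] := ae (a x); [exists x|exists y].
exists (e' \o y); rewrite (_ : a = e \o y); last by apply/funext => x /=; rewrite ey.
by apply/tp0P => phi; rewrite -e'sat -esat.
Qed.

Lemma homogeneity (I : Type) (a b : I -> M) :
  small kappa [set: I] -> tp0 a = tp0 b ->
  exists s, automorphism s /\ s \o a = b.
Proof.
have [_ _ _ homogeneous] := M_monster => Is /tp0P satab.
have /choice[e eP] : forall x, exists y, forall i, a i = x -> b i = y.
  move=> x; have [[i <-]|nx] := pselect (exists i, a i = x).
    by exists (b i) => j; apply: (satab (Eqt (Var L j) (Var L i))).1.
  by exists x => i aix; case: nx; exists i.
have ea : e \o a = b by apply/funext => i /=; rewrite (eP _ _ (erefl (a i))).
have [|n phi v va|s s_aut se] := homogeneous (range a) e; first exact: small_range.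
  have /choice[i iP] : forall k, exists i, a i = v k.
    by move=> k; have [i _ <-] := va k; exists i.
  have -> : v = a \o i by apply/funext => k /=; rewrite iP.
  by rewrite -sat_rename satab sat_rename -ea.
exists s; split=> //; rewrite -ea; apply/funext => i /=.
by apply: se; exists i.
Qed.

Lemma homogeneity_over (S : set M) (I : Type) (a b : I -> M) :
  small kappa S -> small kappa [set: I] -> tp S a = tp S b ->
  exists s, [/\ automorphism s, fixes S s & s \o a = b].
Proof.
move=> Ss Is /homogeneity[|s [s_aut sab]].
  by apply: small_sum => //; exact: small_elem.
exists s; split=> // [x Sx|].
  by have /(congr1 (fun u => u (inr (SigSub (mem_set Sx))))) := sab.
by apply/funext => i; have /(congr1 (fun u => u (inl i))) := sab.
Qed.

Lemma fixes_tcat (S : set M) (s : M -> M) (I : Type) (a : I -> M) :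
  fixes S s -> s \o tcat a (@elem M S) = tcat (s \o a) (@elem M S).
Proof.
by move=> sS; apply/funext => -[i|x] //=; apply: sS; exact: set_valP.
Qed.

(** In the ultrapower the class of the family c realizes the limit type.
    Bring it back into the monster together with the diagonal copy of S, then
    move that copy onto S by an automorphism. *)
Lemma limit_type_realized (J : Type) (W : (J -> Prop) -> Prop) (S : set M)
    (I : Type) (c : J -> I -> M) :
  ultra_quantifier W -> small kappa S -> small kappa [set: I] ->
  exists d : I -> M, forall phi,
    tp S d phi <-> W (fun j => tp S (c j) phi).
Proof.
move=> uW Ss Is; have [MT _ _ _] := M_monster.
have [N [cl los]] := ultrapower M uW.
have NT := ultrapower_models uW los MT.
have Ss' := small_elem Ss.
pose c' x j := tcat (c j) (@elem M S) x.
have [d d_tp] := small_tuple_realized (cl \o c') NT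
  (small_sum kappa_uncountable Is Ss').
have dP phi : sat d phi <-> W (fun j => tp S (c j) phi).
  by move/tp0P: d_tp => ->; exact: los.
have [|s [s_aut sd]] := @homogeneity _ (d \o inr) (@elem M S) Ss'.
  apply/tp0P => phi; rewrite -sat_rename dP -[X in _ <-> X](ultra_const uW).
  by apply: ultra_iff => //; apply: ultra_all => // j; exact: sat_rename.
exists (s \o (d \o inl)) => phi.
rewrite -dP (automorphism_sat s_aut).
suff -> : s \o d = tcat (s \o (d \o inl)) (@elem M S) by [].
by rewrite -sd; apply/funext => -[].
Qed.

End Monster.

(** * Morley pairs of a limit type *)

Section MorleyPairs.
Variables (L : language) (M : structure L) (S : set M) (I : Type).
Variables (U : (nat -> Prop) -> Prop) (a : nat -> I -> M).
Hypothesis U_ultra : ultra_quantifier U.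

(** Let q be the limit along U of the types of the a i over the monster, a
    global type finitely satisfiable in S when the a i lie in S.  A Morley pair
    is a pair (b, d) such that d realizes q over S and b realizes q over S d. *)
Definition morley_pair (b d : I -> M) : Prop :=
  forall phi, tp S (tcat b d) phi <->
    U (fun i => U (fun j => tp S (tcat (a i) (a j)) phi)).

Variables b d : I -> M.
Hypothesis bd : morley_pair b d.

Lemma morley_pair_fst phi : tp S b phi <-> U (fun i => tp S (a i) phi).
Proof.
pose h (z : I + S) : (I + I) + S :=
  match z with inl x => inl (inl x) | inr s => inr s end.
have E (u v : I -> M) : tp S u phi <-> tp S (tcat u v) (rename h phi).
  rewrite /tp /tp0 /= sat_rename.
  suff -> : tcat (tcat u v) (@elem M S) \o h = tcat u (@elem M S) by [].
  by apply/funext => -[].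
rewrite (E b d) bd; apply: ultra_iff => //; apply: ultra_all => // i.
rewrite -(ultra_const U_ultra (tp S (a i) phi)).
by apply: ultra_iff => //; apply: ultra_all => // j; rewrite -E.
Qed.

Lemma morley_pair_snd phi : tp S d phi <-> U (fun j => tp S (a j) phi).
Proof.
pose h (z : I + S) : (I + I) + S :=
  match z with inl x => inl (inr x) | inr s => inr s end.
have E (u v : I -> M) : tp S v phi <-> tp S (tcat u v) (rename h phi).
  rewrite /tp /tp0 /= sat_rename.
  suff -> : tcat (tcat u v) (@elem M S) \o h = tcat v (@elem M S) by [].
  by apply/funext => -[].
rewrite (E b d) bd -[X in _ <-> X](ultra_const U_ultra).
apply: ultra_iff => //; apply: ultra_all => // i.
by apply: ultra_iff => //; apply: ultra_all => // j; rewrite -E.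
Qed.

Hypothesis aS : forall i x, S (a i x).

(** A formula true of (b, d) is true of (a i, d) for some i: as a i lies in S,
    the formula becomes a condition on tp(d/S), which is the limit of the types
    of the a j. *)
Lemma morley_pair_approx phi :
  tp S (tcat b d) phi -> exists i, tp S (tcat (a i) d) phi.
Proof.
move=> /bd /(ultra_ex U_ultra)[i Ui]; exists i.
pose h (z : (I + I) + S) : I + S :=
  match z with
  | inl (inl x) => inr (SigSub (mem_set (aS i x)))
  | inl (inr x) => inl x
  | inr s => inr s
  end.
have E v : tp S (tcat (a i) v) phi <-> tp S v (rename h phi).
  rewrite /tp /tp0 /= sat_rename.
  suff -> : tcat v (@elem M S) \o h = tcat (tcat (a i) v) (@elem M S) by [].
  by apply/funext => -[[]|].
apply/E/morley_pair_snd; apply: ultra_mono Ui => // j; exact: (E _).1.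
Qed.

Lemma morley_pair_coheir : coheir b S d.
Proof.
move=> phi b_phi.
have /choice[k kP] : forall z : (S `|` range d),
    exists y, tcat d (@elem M S) y = elem z.
  move=> z; have [Sz|[x _ dx]] := set_valP z; last by exists (inl x).
  by exists (inr (SigSub (mem_set Sz))).
pose h (z : I + (S `|` range d)) : (I + I) + S :=
  match z with
  | inl x => inl (inl x)
  | inr z => match k z with inl x => inl (inr x) | inr s => inr s end
  end.
have E b' : sat (tcat b' (@elem M (S `|` range d))) phi <->
    tp S (tcat b' d) (rename h phi).
  rewrite /tp /tp0 /= sat_rename.
  suff -> : tcat (tcat b' d) (@elem M S) \o h =
      tcat b' (@elem M (S `|` range d)) by [].
  by apply/funext => -[//|z] /=; rewrite -kP; case: (k z).
have [i ai] := morley_pair_approx ((E b).1 b_phi).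
by exists (a i); [exact: aS|exact/E].
Qed.

Lemma morley_pair_heir : heir d S b.
Proof.
move=> n phi b' b'S d_phi.
have /choice[k kP] : forall i, exists y, tcat b (@elem M S) y = b' i.
  move=> i; have [Sz|[x _ bx]] := b'S i; last by exists (inl x).
  by exists (inr (SigSub (mem_set Sz))).
pose h (z : (I + 'I_n) + S) : (I + I) + S :=
  match z with
  | inl (inl x) => inl (inr x)
  | inl (inr i) => match k i with inl x => inl (inl x) | inr s => inr s end
  | inr s => inr s
  end.
have E u : sat (tcat (tcat d (tcat u (@elem M S) \o k)) (@elem M S)) phi <->
    tp S (tcat u d) (rename h phi).
  rewrite /tp /tp0 /= sat_rename.
  suff -> : tcat (tcat u d) (@elem M S) \o h =
      tcat (tcat d (tcat u (@elem M S) \o k)) (@elem M S) by [].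
  by apply/funext => -[[x|i]|s] //=; case: (k i).
have kb : tcat b (@elem M S) \o k = b' by apply/funext => i; exact: kP.
have [|i ai] := @morley_pair_approx (rename h phi); first by apply/E; rewrite kb.
exists (tcat (a i) (@elem M S) \o k); last exact/E.
by move=> j /=; case: (k j) => [x|s] /=; [exact: aS|exact: set_valP].
Qed.

End MorleyPairs.

(** * The cycle of length four *)

Section Existence.
Variables (L : language) (T : set (sentence L)) (kappa : Type) (M : structure L).
Hypothesis L_countable : countable_language L.
Hypothesis kappa_uncountable : ~ countable [set: kappa].
Hypothesis M_monster : monster kappa T M.

(** The three tuples realize at once the limit type of (a i, a j, a k) along
    the product ultrafilter, i being the outermost variable. *)
Lemma morley_triple (S : set M) (I : Type) (U : (nat -> Prop) -> Prop)
    (a : nat -> I -> M) :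
  ultra_quantifier U -> small kappa S -> small kappa [set: I] ->
  exists b0 b1 b2, morley_pair S U a b0 b1 /\ morley_pair S U a b1 b2.
Proof.
move=> uU Ss Is.
have uW := ultra_iter uU (ultra_iter uU uU).
have Is3 := small_sum kappa_uncountable Is (small_sum kappa_uncountable Is Is).
pose a3 (p : nat * (nat * nat)) := tcat (a p.1) (tcat (a p.2.1) (a p.2.2)).
have [c cP] :=
  limit_type_realized L_countable kappa_uncountable M_monster a3 uW Ss Is3.
exists (c \o inl), (c \o inr \o inl), (c \o inr \o inr).
pose h0 (z : I + I) : (I + (I + I)) + S :=
  inl (match z with inl x => inl x | inr x => inr (inl x) end).
have E0 (u : I + (I + I) -> M) phi :
    tp S (tcat (u \o inl) (u \o inr \o inl)) phi <->
    tp S u (rename (tcat h0 inr) phi).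
  rewrite /tp /tp0 /= sat_rename.
  by apply: sat_occurs => -[[]|].
have E1 (u : I + (I + I) -> M) phi :
    tp S (tcat (u \o inr \o inl) (u \o inr \o inr)) phi <->
    tp S u (rename (tcat (inl \o inr) inr) phi).
  rewrite /tp /tp0 /= sat_rename.
  by apply: sat_occurs => -[[]|].
split=> phi.
  rewrite E0 cP; apply: ultra_iff => //; apply: ultra_all => // i.
  apply: ultra_iff => //; apply: ultra_all => // j.
  rewrite -(ultra_const uU (tp S (tcat (a i) (a j)) phi)).
  by apply: ultra_iff => //; apply: ultra_all => // k; rewrite -E0.
rewrite E1 cP -[X in _ <-> X](ultra_const uU).
apply: ultra_iff => //; apply: ultra_all => // i.
apply: ultra_iff => //; apply: ultra_all => // j.
by apply: ultra_iff => //; apply: ultra_all => // k; rewrite -E1.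
Qed.

Lemma indiscernible_pair (I : Type) (a : nat -> I -> M) i j :
  indiscernible a -> i < j -> tp0 (tcat (a i) (a j)) = tp0 (tcat (a 0) (a 1)).
Proof.
move=> a_ind ij.
pose f (i j : nat) (k : 'I_2) := if val k == 0 then i else j.
have f_inc u v : u < v -> forall x y : 'I_2, x < y -> f u v x < f u v y.
  by move=> uv [[|[]]//= ?] [[|[]]//= ?].
have /tp0P E := a_ind 2 (f i j) (f 0 1) (f_inc _ _ ij) (f_inc 0 1 isT).
pose r : I + I -> 'I_2 * I := tcat (pair ord0) (pair ord_max).
have F u v : tcat (a u) (a v) = (fun z => a (f u v z.1) z.2) \o r.
  by apply/funext => -[].
by apply/tp0P => phi; rewrite !F -!sat_rename.
Qed.

Lemma morley_pair_tp0 (S : set M) (I : Type) (U : (nat -> Prop) -> Prop)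
    (a : nat -> I -> M) (b d : I -> M) :
  ultra_quantifier U -> (forall n, U (fun i => n < i)) -> indiscernible a ->
  morley_pair S U a b d -> tp0 (tcat b d) = tp0 (tcat (a 0) (a 1)).
Proof.
move=> uU Utail a_ind bd; apply/tp0P => phi.
have E (u v : I -> M) : sat (tcat u v) phi <-> tp S (tcat u v) (rename inl phi).
  by rewrite /tp /tp0 /= sat_rename.
rewrite (E b d) bd -(ultra_const uU (sat (tcat (a 0) (a 1)) phi)).
apply: ultra_iff => //; apply: ultra_all => // i.
rewrite -(ultra_const uU (sat (tcat (a 0) (a 1)) phi)).
apply: ultra_iff => //; apply: ultra_mono (Utail i) => // j ij.
by rewrite -E; have /tp0P := indiscernible_pair a_ind ij.
Qed.

Lemma small_model_around (X : Type) (a : X -> M) :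
  small kappa [set: X] ->
  exists2 S : set M, small_model kappa S & range a `<=` S.
Proof.
move=> /(lowenheim_skolem kappa_uncountable L_countable a).
move=> [N [e [_ esat eS ae]]]; exists (range e) => //; split=> //.
by exists N, e; split=> // n phi v _; exact: esat.
Qed.

Lemma tp_automorphism (S : set M) (s : M -> M) (I : Type) (a : I -> M) :
  automorphism s -> fixes S s -> tp S (s \o a) = tp S a.
Proof.
move=> s_aut sS; apply/tp0P => phi.
by rewrite -fixes_tcat // -automorphism_sat.
Qed.

(** If s exchanges b0 and b2, then b0, b1, b2, s b1 is a cycle of p. *)
Lemma four_cycle (I : Type) (p : set (formula L (I + I)))
    (b0 b1 b2 : I -> M) (s : M -> M) :
  automorphism s -> s \o b0 = b2 -> s \o b2 = b0 ->
  tp0 (tcat b0 b1) = p -> tp0 (tcat b1 b2) = p ->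
  consistent T (cycle_type 4 p).
Proof.
move=> s_aut s0 s2 p01 p12; have [MT _ _ _] := M_monster.
have s_tp (u v : I -> M) : tp0 (tcat (s \o u) (s \o v)) = tp0 (tcat u v).
  by apply/tp0P => phi; rewrite -tcat_comp -automorphism_sat.
pose c (k : nat) := nth b0 [:: b0; b1; b2; s \o b1] k.
exists M, (fun z => c (val z.1) z.2); split=> // _ [k _ [phi pphi <-]].
rewrite sat_rename.
have -> : (fun z : 'I_4 * I => c (val z.1) z.2) \o
      tcat (fun i => (k, i)) (fun i => (ordS k, i)) =
    tcat (c (val k)) (c (val (ordS k))) by apply/funext => -[].
rewrite -[sat _ _]/(tp0 _ phi).
case: k => -[|[|[|[|//]]]] k4; rewrite /c /=.
- by rewrite p01.
- by rewrite p12.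
- by rewrite -s0 s_tp p01.
- by rewrite -[X in tcat _ X]s2 s_tp p12.
Qed.

Variable ind : set M -> set M -> set M -> Prop.
Hypothesis ind_invariant : aut_invariant kappa ind.
Hypothesis ind_symmetry : symmetry kappa ind.
Hypothesis ind_stationarity : stationarity_over_models kappa ind.

(** Let s be an automorphism over S that maps c to b.  Then s b and c are both
    independent from b over S and have the same type over S, hence the same type
    over S b; so (b, c), (s b, b) and (c, b) have the same type over S. *)
Lemma independent_swap (S : set M) (I : Type) (b c : I -> M) :
  small_model kappa S -> small kappa [set: I] ->
  tp S b = tp S c -> ind (range b) S (range c) ->
  exists s, [/\ automorphism s, s \o b = c & s \o c = b].
Proof.
move=> Sm Is bc bSc; have [Ss _] := Sm.
have rs (u : I -> M) : small kappa (range u) by apply: small_range.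
have [s [s_aut sS sc]] :=
  homogeneity_over kappa_uncountable M_monster Ss Is (esym bc).
have img (t : M -> M) (A : set M) : fixes A t -> t @` A = A.
  move=> tA; apply/seteqP; split=> [_ [x Ax <-]|x Ax]; first by rewrite tA.
  by exists x => //; exact: tA.
have sbSb : ind (range (s \o b)) S (range b).
  have := (ind_invariant (rs b) (rs c) Ss s_aut).1 bSc.
  by rewrite (img _ _ sS) !image_comp sc.
have cSb : ind (range c) S (range b) by apply: ind_symmetry.
have : equiv_tuple (S `|` range b) (s \o b) c.
  apply: ind_stationarity => //.
  by rewrite /equiv_tuple tp_automorphism.
move=> /esym /(homogeneity_over kappa_uncountable M_monster).
move=> [|//|r [r_aut rSb rc]]; first exact: small_setU.
have [r' [r'_aut rK r'K]] := automorphism_inv r_aut.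
have rb : r \o b = b by apply/funext => i /=; apply: rSb; right; exists i.
exists (r' \o s); split; first exact: automorphism_comp.
  apply/funext => i; apply: (can_inj rK).
  by rewrite /= r'K -[r (c i)]/((r \o c) i) rc.
apply/funext => i; apply: (can_inj rK); rewrite /= r'K.
by rewrite -[r (b i)]/((r \o b) i) rb -[s (c i)]/((s \o c) i) sc.
Qed.

End Existence.

Theorem theorem3p3p12 (L : language) (L_countable : countable_language L)
    (T : set (sentence L)) (T_complete : complete_theory T)
    (T_infinite : forall N : structure L, models T N -> infinite_set [set: N])
    (kappa : Type) (kappa_uncountable : ~ countable [set: kappa])
    (M : structure L) (M_monster : monster kappa T M)
    (ind : set M -> set M -> set M -> Prop)
    (ind_invariant : aut_invariant kappa ind)
    (ind_symmetry : symmetry kappa ind)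
    (ind_full_existence : full_existence kappa ind)
    (ind_stationarity : stationarity_over_models kappa ind)
    (ind_weak_transitivity : weak_transitivity_over_models kappa ind) :
  NSOP kappa T M 4.
Proof.
move=> [I [a [Is a_ind]]]; apply.
have [U uU Utail] := nonprincipal_ultra_quantifier.
have [|S Sm aS'] := small_model_around L_countable kappa_uncountable
  (fun z : nat * I => a z.1 z.2).
  by apply: small_prod => //; apply: small_countable => //; exact: countableP.
have aS i x : S (a i x) by apply: aS'; exists (i, x).
have [Ss _] := Sm.
have [b0 [b1 [b2 [b01 b12]]]] :=
  morley_triple L_countable kappa_uncountable M_monster a uU Ss Is.
have rs (u : I -> M) : small kappa (range u) by apply: small_range.
(* Replace b2 by a conjugate over S b1 that is independent from b0 over S b1. *)
have Sb1 := small_setU kappa_uncountable Ss (rs b1).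
have [A [s [s_aut sfix sA]] Ab0] := ind_full_existence _ _ _ (rs b2) (rs b0) Sb1.
have [t [t_aut sK tK]] := automorphism_inv s_aut.
have tfix : fixes (S `|` range b1) t.
  by move=> x Sx; rewrite -[in LHS](sfix x Sx) sK.
pose c := t \o b2.
have Ac : A = range c.
  have -> : range c = t @` range b2 by rewrite image_comp.
  rewrite -sA image_comp; apply/seteqP; split=> [x Ax|_ [x Ax <-]].
    by exists x => //=; rewrite sK.
  by rewrite /= sK.
have tb1 : t \o b1 = b1 by apply/funext => i; apply: tfix; right; exists i.
have b1c : morley_pair S U a b1 c.
  move=> phi; rewrite -b12 -[in X in X <-> _]tb1 -tcat_comp tp_automorphism //.
  by move=> x Sx; apply: tfix; left.
have cb0 : ind (range c) S (range b0).
  apply: (ind_weak_transitivity S I I I c b0 b1) => //; first by rewrite -Ac.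
    exact: (morley_pair_heir uU b1c aS).
  exact: (morley_pair_coheir uU b01 aS).
have c_b0 : tp S b0 = tp S c.
  apply/tp0P => phi; rewrite -[sat _ _]/(tp S b0 phi) -[X in _ <-> X]/(tp S c phi).
  by rewrite (morley_pair_fst uU b01) (morley_pair_snd uU b1c).
have [r [r_aut rc rb]] :=
  independent_swap kappa_uncountable M_monster ind_invariant ind_symmetry
    ind_stationarity Sm Is (esym c_b0) cb0.
apply: (four_cycle M_monster r_aut rb rc).
  exact: morley_pair_tp0 uU Utail a_ind b01.
exact: morley_pair_tp0 uU Utail a_ind b1c.
Qed.
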